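(* Let $k\ge 1$. For every positive integer $n$, $$C_k(n)-C_k(n-1)=\mathcal{P}_{2,1}(n,k)-\mathcal{P}_{2,1}^{>1}(n,k).$$
   Context: A $k$-color partition of $n$ is a finite multiset of positive integers (parts), each carrying one of the $k$ colors $color(1),\dots,color(k)$, whose sum is $n$; repetitions are allowed. $\mathcal{C}_k(n)$ is the set of all $k$-color partitions of $n$, and $C_k(n)=|\mathcal{C}_k(n)|$ (so $\sum_{n\ge0}C_k(n)q^n=\prod_{j\ge1}(1-q^j)^{-k}$), with $C_k(n)=0$ when $n$ is not a non-negative integer. For $\lambda\in\mathcal{C}_k(n)$, $\mathrm{mex}_{2,1}(\lambda_k)$ is the smallest positive integer $\equiv 1 \pmod 2$ that does not occur as a part in $color(k)$ of $\lambda$. $\mathcal{P}_{2,1}(n,k)$ is the number of $\lambda\in\mathcal{C}_k(n)$ with $\mathrm{mex}_{2,1}(\lambda_k)\equiv 1\pmod 4$, and $\mathcal{P}_{2,1}^{>1}(n,k)$ is the number of $\lambda\in\mathcal{C}_k(n)$ with $\mathrm{mex}_{2,1}(\lambda_k)\equiv 1\pmod 4$ and $\mathrm{mex}_{2,1}(\lambda_k)>1$. *)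

(* Defs.v *)
From mathcomp Require Import all_boot all_order all_algebra.
From mathcomp Require Import finmap multiset.

Set Implicit Arguments.
Unset Strict Implicit.
Unset Printing Implicit Defensive.

Local Open Scope fset_scope.
Local Open Scope mset_scope.
Local Open Scope nat_scope.

(* A part of size m in color(c) is the pair (m, c), with colors numbered
   1, ..., k as in color(1), ..., color(k). *)
Notation colored_part := (nat * nat)%type.

Definition is_color_partition (k n : nat) (l : {mset colored_part}) : bool :=
  all (fun x : colored_part => (0 < x.1) && (1 <= x.2 <= k)) l &&
  (\sum_(x <- l) x.1 == n).

(* Multisets of size at most n with elements in s. *)
Fixpoint bounded_msets (T : choiceType) (s : seq T) (n : nat) :
    {fset {mset T}} :=
  if n is m.+1 then
    (bounded_msets s m `|`
     [fset (x +` l)%mset | x in s, l in bounded_msets s m])%fset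
  else [fset mset0].

Lemma in_bounded_msets (T : choiceType) (s : seq T) (n : nat) (l : {mset T}) :
  size l <= n -> {subset l <= s} -> l \in bounded_msets s n.
Proof.
elim: n l => [|n IHn] l /=.
  by rewrite leqn0 size_mset_eq0 => /eqP-> _; rewrite inE.
have [->|[x xl]] := mset_0Vmem l => [_ _|].
  by rewrite inE IHn ?size_mset0 // => x; rewrite in_mset0.
move=> szl sub_l; rewrite inE; apply/orP; right.
apply/imfset2P; exists x; first exact: sub_l.
have Dl := msetB1K xl; exists (l `\ x) => //.
apply: IHn => [|y yl]; last by apply: sub_l; rewrite -Dl in_mset1D yl orbT.
rewrite -ltnS; apply: leq_trans szl.
rewrite -{2}Dl -[in leqRHS](seq_mset_id (l `\ x)) -mset_cons.
by rewrite (perm_size (perm_eq_seq_mset _)).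
Qed.

(* The parts of a partition of n are at most n, and there are at most n of them,
   so the ambient finite set loses nothing: see in_color_partitions. *)
Definition color_partitions (k n : nat) : {fset {mset colored_part}} :=
  [fset l in bounded_msets
      [seq (m, c) : colored_part | m <- iota 1 n, c <- iota 1 k] n
    | is_color_partition k n l].

Lemma in_color_partitions (k n : nat) (l : {mset colored_part}) :
  (l \in color_partitions k n) = is_color_partition k n l.
Proof.
rewrite !inE /=; apply: andb_idl => /andP[/allP lP /eqP Dn].
apply: in_bounded_msets => [|[m c] xl].
  rewrite -sum1_size -Dn big_seq [leqRHS]big_seq.
  by apply: leq_sum => x /lP/andP[].
have /= /andP[m_gt0 cP] := lP _ xl.
apply/allpairsP; exists (m, c); split => //=; rewrite mem_iota add1n //.
by rewrite m_gt0 /= -Dn (big_rem _ xl) leq_addr.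
Qed.

(* C_k(n) *)
Definition num_color_partitions (k n : nat) : nat := #|` color_partitions k n|.

Lemma mex21_exists (c : nat) (l : {mset colored_part}) :
  exists m, [&& 0 < m, m == 1 %[mod 2] & (m, c) \notin l].
Proof.
exists (\sum_(x <- l) x.1).*2.+1; rewrite /= !modn2 /= odd_double /=.
apply/negP => xl; have : (\sum_(x <- l) x.1).*2.+1 <= \sum_(x <- l) x.1.
  by rewrite {2}(big_rem _ xl) leq_addr.
by rewrite -addnn ltnNge leq_addr.
Qed.

(* mex_{2,1}(l_c), where l_c is the set of parts of l in color(c) *)
Definition mex21 (c : nat) (l : {mset colored_part}) : nat :=
  ex_minn (mex21_exists c l).

(* P_{2,1}(n,k) *)
Definition P21 (n k : nat) : nat :=
  #|` [fset l in color_partitions k n | mex21 k l == 1 %[mod 4]]|.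

(* P_{2,1}^{>1}(n,k) *)
Definition P21_gt1 (n k : nat) : nat :=
  #|` [fset l in color_partitions k n
        | (mex21 k l == 1 %[mod 4]) && (1 < mex21 k l)]|.

(* Main.v *)
(* A partition has mex 1 exactly when it lacks the part 1 in color k, so the
   right-hand side counts the partitions of n without that part; adding one copy
   of it matches the partitions of n-1 with the remaining partitions of n. *)
Require Import Defs.
From mathcomp Require Import all_boot all_order all_algebra.
From mathcomp Require Import finmap multiset zify.

Local Open Scope mset_scope.
Local Open Scope ring_scope.

Lemma mex21_gt0 (c : nat) (l : {mset colored_part}) : (0 < mex21 c l)%N.
Proof. by rewrite /mex21; case: ex_minnP => m /and3P[]. Qed.

(** 1 is odd and the least positive integer, so it is the minimum as soon as it is a candidate. *)
Lemma mex21_eq1 (c : nat) (l : {mset colored_part}) :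
  (mex21 c l == 1)%N = ((1%N, c) \notin l).
Proof.
rewrite /mex21; case: ex_minnP => m /and3P[m_gt0 _ ml] m_min.
apply/eqP/idP => [<- //|l1]; apply/eqP; rewrite eqn_leq m_gt0 andbT.
by apply: m_min; rewrite l1.
Qed.

(* Plain [inE] would also unfold the set A. *)
Lemma in_fset_filter (T : choiceType) (A : {fset T}) (P : pred T) (x : T) :
  (x \in [fset y in A | P y]%fset) = (x \in A) && P x.
Proof. by rewrite !inE. Qed.

Lemma card_fset_filterID (T : choiceType) (A : {fset T}) (P Q : pred T) :
  #|` [fset x in A | P x]%fset|
  = (#|` [fset x in A | P x && Q x]%fset|
     + #|` [fset x in A | P x && ~~ Q x]%fset|)%N.
Proof.
rewrite -(cardfsID [fset x in A | Q x]%fset [fset x in A | P x]%fset).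
by congr addn; congr #|` _|; apply/fsetP => x; rewrite !inE /=;
  case: (x \in A); case: (P x); case: (Q x).
Qed.

(** A mex that fails to exceed 1 equals 1, which already satisfies the congruence mod 4. *)
Lemma P21_split (n k : nat) :
  P21 n k = (P21_gt1 n k
    + #|` [fset l in color_partitions k n
           | (1%N, k) \notin (l : {mset colored_part})]%fset|)%N.
Proof.
rewrite /P21 (card_fset_filterID _ _ _ (fun l => 1 < mex21 k l)%N).
congr addn; congr #|` _|; apply/fsetP => l; rewrite !in_fset_filter -mex21_eq1 -leqNgt.
congr (_ && _); apply/andP/eqP => [[_ m_le1]|-> //].
by apply/eqP; rewrite eqn_leq m_le1 mex21_gt0.
Qed.

Lemma is_color_partitionD1 (k n : nat) (x : colored_part)
    (l : {mset colored_part}) :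
  is_color_partition k (x.1 + n) (x +` l)%mset
  = (0 < x.1)%N && (1 <= x.2 <= k)%N && is_color_partition k n l.
Proof.
(* The enumeration of a multiset has an order of its own, so adding [x] is a cons only up to
   permutation. *)
have D : perm_eq (x +` l)%mset (x :: l).
  rewrite -[X in perm_eq (x +` X)%mset _]seq_mset_id -mset_cons.
  by rewrite perm_eq_seq_mset.
rewrite /is_color_partition (perm_all _ D) (perm_big _ D) big_cons /=.
by rewrite eqn_add2l -!andbA.
Qed.

(** Adding a copy of [(1, k)] is injective, and its image is the set on the left, since a copy that
    occurs can be removed again. *)
Lemma card_color_partitions_with1 (k n : nat) : (1 <= k)%N ->
  #|` [fset l in color_partitions k n.+1
      | (1%N, k) \in (l : {mset colored_part})]%fset|
  = num_color_partitions k n.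
Proof.
move=> k_gt0; pose x : colored_part := (1%N, k).
(* [k_gt0] puts the color [k] in the range from 1 to [k], so [x] is a legal part. *)
have addP l : is_color_partition k n.+1 (x +` l)%mset = is_color_partition k n l.
  by rewrite -add1n (is_color_partitionD1 k n x) /= k_gt0 leqnn.
have addI : injective (msetD [mset x]%mset).
  by move=> l1 l2 E; rewrite -(msetD1K x l1) E msetD1K.
have <- : #|` [fset (x +` l)%mset | l in color_partitions k n]%fset|
    = num_color_partitions k n by rewrite card_imfset.
congr #|` _|; apply/fsetP => l; rewrite in_fset_filter in_color_partitions.
apply/andP/imfsetP => [[lP xl]|[l' /= l'P ->]].
  exists (l `\ x)%mset; last by rewrite msetB1K.
  by rewrite /= in_color_partitions -addP (msetB1K xl).
by rewrite addP -in_color_partitions l'P in_mset1D eqxx.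
Qed.

Theorem theorem1p3 (k : nat) (hk : (1 <= k)%N) (n : nat) (hn : (0 < n)%N) :
  (num_color_partitions k n)%:Z - (num_color_partitions k (n - 1)%N)%:Z
  = (P21 n k)%:Z - (P21_gt1 n k)%:Z.
Proof.
case: n hn => // n _.
rewrite subn1 /= P21_split -(card_color_partitions_with1 k n hk).
(* The trivial filter gives the count the form that [card_fset_filterID] splits. *)
have -> : num_color_partitions k n.+1
    = #|` [fset l in color_partitions k n.+1 | true]%fset|.
  by congr #|` _|; apply/fsetP => l; rewrite in_fset_filter andbT.
rewrite (card_fset_filterID _ _ _
  (fun l : {mset colored_part} => (1%N, k) \in l)) /=.
(* After cancellation both sides count the partitions of [n.+1] without the part [(1, k)]. *)
lia.
Qed.
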